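(* Let $k$ be a positive integer. Then there is an $o$-symmetric convex body $C\subset\mathbb{R}^3$ and a set $X\subset\mathbb{R}^3$ such that $o\in\operatorname{conv}_C^b(X)$, but for every $Y\subset X$ with $\operatorname{card}Y<k$ we have $o\notin\operatorname{conv}_C^b(Y)$.
   Context: $o$ denotes the origin. A convex body is a compact convex set with non-empty interior; $o$-symmetric means $C=-C$. A set $K\subset\mathbb{R}^3$ is $C$-ball convex if it is $\emptyset$, or $\mathbb{R}^3$, or the intersection of all translates of $C$ that contain $K$. The $C$-ball convex hull $\operatorname{conv}_C^b(A)$ of $A$ is the intersection of all $C$-ball convex sets that contain $A$; so for $A\ne\emptyset$ it is the intersection of all translates of $C$ that contain $A$ (and $\mathbb{R}^3$ if there is no such translate), and $\operatorname{conv}_C^b(\emptyset)=\emptyset$. *)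

(* Defs.v *)
From mathcomp Require Import all_boot all_order all_algebra.
From mathcomp Require Import all_classical all_reals all_analysis.

Set Implicit Arguments.
Unset Strict Implicit.
Unset Printing Implicit Defensive.

Import Order.TTheory GRing.Theory Num.Theory.
Import numFieldNormedType.Exports.

Local Open Scope classical_set_scope.
Local Open Scope ring_scope.

(* ['rV[R]_3] carries the product topology (sup norm), which on R^3 is the
   Euclidean topology. *)
Definition convex_body (R : realType) (C : set 'rV[R]_3) : Prop :=
  [/\ compact C, convex_set C & C° !=set0].

Definition o_symmetric (R : realType) (C : set 'rV[R]_3) : Prop :=
  C = [set - c | c in C].

Definition translate (R : realType) (C : set 'rV[R]_3) (x : 'rV[R]_3) :
  set 'rV[R]_3 := [set x + c | c in C].

(* When no translate of C contains K, the intersection ranges over an empty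
   family and is the whole space. *)
Definition ball_convex (R : realType) (C K : set 'rV[R]_3) : Prop :=
  [\/ K = set0, K = setT |
      K = \bigcap_(x in [set x | K `<=` translate C x]) translate C x].

Definition ball_hull (R : realType) (C A : set 'rV[R]_3) : set 'rV[R]_3 :=
  \bigcap_(K in [set K | ball_convex C K /\ A `<=` K]) K.

(* Main.v *)
(* The body C has top face F = {x^2 - 12 <= y <= - 2 x^2} at height 12 and
   bottom face - F at height - 12.  By symmetry, a translate p + C contains a
   point q iff p lies in q + C.  The point (0, 1, 0) forces p to have height at
   most 12, and the points (- t, 2 t^2 - 12, 24) force height at least 12, so
   that p lies on the bottom faces of their translates.  There the upper boundary
   of the t-th translate is the parabola y = - 2 x^2 + (x - t)^2, which touches
   the upper boundary y = - 2 x^2 of F at x = t only.  All t in [-1, 1] together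
   confine p to F, i.e. the hull contains the origin; finitely many t leave room
   for p just above y = - 2 x^2. *)
Require Import Defs.
From mathcomp Require Import all_boot all_order all_algebra.
From mathcomp Require Import all_classical all_reals all_analysis.
From mathcomp Require Import lra.
Import Order.TTheory GRing.Theory Num.Theory.
Import numFieldNormedType.Exports.
Local Open Scope classical_set_scope.
Local Open Scope ring_scope.

Lemma translateE (R : realType) (C : set 'rV[R]_3) (p q : 'rV[R]_3) :
  translate C p q <-> C (q - p).
Proof.
split=> [[c Cc <-]|Cqp]; first by rewrite addrAC subrr add0r.
by exists (q - p); rewrite // addrCA subrr addr0.
Qed.

Lemma o_symmetricP (R : realType) (C : set 'rV[R]_3) :
  o_symmetric C <-> forall p, C p -> C (- p).
Proof.
split=> [CN p Cp|CN]; first by rewrite CN; exists p.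
apply/seteqP; split=> [p Cp|p [q Cq <-]]; last exact: CN.
by exists (- p); rewrite ?opprK //; exact: CN.
Qed.

Lemma ball_convex_translate (R : realType) (C : set 'rV[R]_3) (p : 'rV[R]_3) :
  ball_convex C (translate C p).
Proof.
apply: Or33; apply/seteqP; split=> [q pq x /= sub|q]; first exact: sub.
exact.
Qed.

Lemma ball_hull_sub_translate (R : realType) (C A : set 'rV[R]_3) p :
  A `<=` translate C p -> ball_hull C A `<=` translate C p.
Proof. by move=> Ap q; apply; split=> //; exact: ball_convex_translate. Qed.

(** Nonemptiness of [A] rules out [set0], which is ball convex by decree; every other ball convex
    [K] contains what all the translates around [A] contain. *)
Lemma mem_ball_hull (R : realType) (C A : set 'rV[R]_3) q : A !=set0 ->
  (forall p, A `<=` translate C p -> translate C p q) -> ball_hull C A q.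
Proof.
move=> [a Aa] Aq K [[->|->|KE] AK] //; first by have := AK _ Aa.
by rewrite KE => p Kp; apply: Aq; exact: subset_trans Kp.
Qed.

Lemma interval_avoiding_seq (R : realFieldType) (s : seq R) (a b : R) :
  a < b -> exists c d, [/\ a <= c, c < d, d <= b &
    forall t, t \in s -> t < c \/ d < t].
Proof.
elim: s a b => [|u s IHs] a b ab; first by exists a, b.
have [um|mu] := leP u ((a + b) / 2).
  (* The three-quarter point is used because [u] may equal the midpoint, while [u < c] has to be
     strict. *)
  have /IHs[c [d [ac cd db cds]]] : (a + b * 3) / 4 < b by lra.
  exists c, d; split=> // [|t]; first lra.
  by rewrite inE => /orP[/eqP ->|/cds //]; left; lra.
have /IHs[c [d [ac cd db cds]]] : a < (a + b) / 2 by lra.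
exists c, d; split=> // [|t]; first lra.
by rewrite inE => /orP[/eqP ->|/cds //]; right; lra.
Qed.

Definition pt3 {R : realType} (x y z : R) : 'rV[R]_3 :=
  \row_(i < 3) [:: x; y; z]`_i.

(** The first two bounds are those of $F$, each relaxed by $12 - z$ as the height $z$ falls; the
    last two are their mirror images under negation and cut out $-F$ at height $-12$. *)
Definition counterexample_body {R : realType} : set 'rV[R]_3 :=
  [set p | let x := p 0 0 in let y := p 0 1 in let z := p 0 ord_max in
    - 12 <= z <= 12 /\
    [/\ y + 2 * x ^+ 2 <= 12 - z, x ^+ 2 - y <= 24 - z,
        - y + 2 * x ^+ 2 <= 12 + z & x ^+ 2 + y <= 24 + z]].

Definition counterexample_points {R : realType} : set 'rV[R]_3 :=
  pt3 0 1 0 |`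
  [set pt3 (- t) (2 * t ^+ 2 - 12) 24 | t in [set t : R | - 1 <= t <= 1]].

Lemma counterexample_body_sym (R : realType) :
  o_symmetric (@counterexample_body R).
Proof.
apply/o_symmetricP => p [] /=; rewrite /counterexample_body /= !mxE => /andP[].
by move=> ? ? [? ? ? ?]; split; [|split]; lra.
Qed.

Lemma counterexample_body_compact (R : realType) :
  compact (@counterexample_body R).
Proof.
(* A coarse box: $|z| \le 12$ forces $|y| \le 24$, and adding the two bounds that contain $2x^2$
   gives $x^2 \le 6$. *)
have box :
    compact [set p : 'rV[R]_3 | forall i, `[- 72, 72]%classic (p ord0 i)].
  apply: (@rV_compact R 3 (fun=> `[- 72, 72]%classic)) => _.
  exact: segment_compact.
apply: (subclosed_compact _ box).
- have clo (f : 'rV[R]_3 -> R) a : continuous f -> closed [set p | f p <= a].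
    move=> fc; rewrite -[X in closed X]/(f @^-1` [set x | x <= a]).
    by apply: preimage_closed (@closed_le _ _) => p _; exact: fc.
  have contD (f g : 'rV[R]_3 -> R) :
      continuous f -> continuous g -> continuous (fun p => f p + g p).
    by move=> fc gc p; exact: (@continuousD _ _ _ f g p (fc p) (gc p)).
  have contM (f g : 'rV[R]_3 -> R) :
      continuous f -> continuous g -> continuous (fun p => f p * g p).
    by move=> fc gc p; exact: (@continuousM _ _ f g p (fc p) (gc p)).
  have contN (f : 'rV[R]_3 -> R) :
      continuous f -> continuous (fun p => - f p).
    by move=> fc p; exact: (@continuousN _ _ _ f p (fc p)).
  pose x (p : 'rV[R]_3) := p 0 0; pose y (p : 'rV[R]_3) := p 0 1.
  pose z (p : 'rV[R]_3) := p 0 ord_max.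
  have [xc yc zc] : [/\ continuous x, continuous y & continuous z].
    by split; exact: coord_continuous.
  rewrite (_ : counterexample_body =
      [set p | - z p <= 12] `&` [set p | z p <= 12] `&`
      [set p | y p + 2 * (x p * x p) + z p <= 12] `&`
      [set p | x p * x p - y p + z p <= 24] `&`
      [set p | - y p + 2 * (x p * x p) - z p <= 12] `&`
      [set p | x p * x p + y p - z p <= 24]).
    do !apply: closedI; apply: clo;
      do ?[exact: xc | exact: yc | exact: zc | exact: cst_continuous
          | apply: (contD) | apply: (contN) | apply: (contM)].
  apply/seteqP; rewrite /counterexample_body /x /y /z.
  split=> p /= => [[/andP[? ?] [? ? ? ?]]|[[[[[? ?] ?] ?] ?] ?]].
    by do !split; lra.
  by split; [|split]; lra.
- move=> p [] /=; set x := p 0 0; set y := p 0 1; set z := p 0 ord_max.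
  move=> /andP[? ?] [? ? ? ?]; have x0 := sqr_ge0 x.
  case=> -[|[|[|//]]] i3; rewrite in_itv /=.
  + rewrite (_ : p 0 _ = x); first by apply/andP; split; nra.
    by congr (p 0 _); exact: val_inj.
  + by rewrite (_ : p 0 _ = y); [lra | congr (p 0 _); exact: val_inj].
  + by rewrite (_ : p 0 _ = z); [lra | congr (p 0 _); exact: val_inj].
Qed.

Lemma counterexample_body_convex (R : realType) :
  convex_set (@counterexample_body R).
Proof.
move=> p q l; rewrite !inE /counterexample_body /=.
move=> [/andP[p1 p2] [p3 p4 p5 p6]] [/andP[q1 q2] [q3 q4 q5 q6]].
have l0 : 0 <= l%:num by []. have l1 : l%:num <= 1 by [].
have comb (a b a' b' : R) : a <= b -> a' <= b' ->
    l%:num * a + (1 - l%:num) * a' <= l%:num * b + (1 - l%:num) * b'.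
  by move=> ab ab'; rewrite lerD// ler_wpM2l ?subr_ge0.
have := comb _ _ _ _ p1 q1; have := comb _ _ _ _ p2 q2.
have := comb _ _ _ _ p3 q3; have := comb _ _ _ _ p4 q4.
have := comb _ _ _ _ p5 q5; have := comb _ _ _ _ p6 q6.
(* This is the convexity defect of the square, $l a^2 + (1-l) b^2 - (l a + (1-l) b)^2$; with it the
   rest is linear in the monomials. *)
have : 0 <= l%:num * (1 - l%:num) * (p 0 0 - q 0 0) ^+ 2.
  by apply: mulr_ge0 (sqr_ge0 _); rewrite mulr_ge0 ?subr_ge0.
rewrite /conv /= !mxE /unstable.onem.
move: (l%:num) (p 0 0) (p 0 1) (p 0 ord_max) (q 0 0) (q 0 1) (q 0 ord_max).
by move=> m ? ? ? ? ? ? *; split; [|split]; lra.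
Qed.

Lemma counterexample_body_interior (R : realType) :
  (@counterexample_body R)° !=set0.
Proof.
exists 0; apply/nbhs_ballP; exists 1 => //= p [_ p1].
have {p1}p1 i : `|p 0 i| < 1.
  by have := p1 0 i; rewrite /ball /= mxE sub0r normrN.
have := p1 0; have := p1 1; have := p1 ord_max; rewrite !ltr_norml.
move=> /andP[? ?] /andP[? ?] /andP[? ?].
by rewrite /counterexample_body /=; split; [|split]; nra.
Qed.

Lemma ball_hull_counterexample_points (R : realType) :
  ball_hull (@counterexample_body R) counterexample_points 0.
Proof.
apply: mem_ball_hull => [|p Xp]; first by exists (pt3 0 1 0); left.
have X0 : counterexample_points (pt3 (0 : R) 1 0) by left.
have Xt (t : R) : - 1 <= t <= 1 ->
    counterexample_points (pt3 (- t) (2 * t ^+ 2 - 12) 24).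
  by move=> ht; right; exists t.
have {}Xt t ht := Xp _ (Xt t ht); have {Xp} := Xp _ X0.
move=> /translateE; rewrite /counterexample_body /= !mxE /=.
move=> [/andP[z1 z2] [y1 y2 y3 y4]].
have {}Xt (t : R) : - 1 <= t <= 1 ->
    counterexample_body (pt3 (- t) (2 * t ^+ 2 - 12) 24 - p).
  by move=> ht; apply/translateE; exact: Xt.
move: Xt z1 z2 y1 y2 y3 y4; rewrite /counterexample_body /=.
set x := p 0 0; set y := p 0 1; set z := p 0 ord_max => Xt *.
have z12 : z = 12.
  by have [|] := Xt 0; [lra | rewrite !mxE /= -/z; lra].
have {}Xt t : - 1 <= t <= 1 ->
    2 * t ^+ 2 - 12 + 2 * (x + t) ^+ 2 <= y <= 2 * t ^+ 2 - (x + t) ^+ 2.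
  by move=> /Xt; rewrite !mxE /= -/x -/y -/z z12 => -[_ [? ? _ _]]; lra.
(* The two bounds at $t = 1$ are compatible only if $3(x+1)^2 \le 12$, so $x \le 1$; likewise $t =
   -1$ gives $x \ge -1$. *)
have /andP[? ?] : - 1 <= x <= 1.
  by have := Xt 1 ltac:(lra); have := Xt (-1) ltac:(lra); nra.
(* Now $t = x$ is an admissible parameter, and its bounds read $10x^2 - 12 \le y \le -2x^2$, which
   puts $(x, y)$ in $F$. *)
have /andP[? ?] := Xt x ltac:(lra).
apply/translateE; rewrite sub0r /= !mxE -/x -/y -/z z12.
by split; [|split]; nra.
Qed.

Lemma finite_counterexample_points (R : realType) (Y : set 'rV[R]_3) :
  finite_set Y -> Y `<=` counterexample_points ->
  ~ ball_hull counterexample_body Y 0.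
Proof.
move=> /finite_seqP[s ->] sX.
(* Negated first coordinates recover the parameters $t$; the point $(0, 1, 0)$ merely adds the value
   $0$ to avoid. *)
have [c [d [c1 cd d1 cds]]] :=
  @interval_avoiding_seq R [seq - (p 0 0) | p : 'rV[R]_3 <- s] (-1) 1
    ltac:(lra).
(* Every $t$ outside $[c, d]$ satisfies $(x-t)^2 \ge e$, so a point $e$ above $y = -2x^2$ respects
   the upper boundary for each listed $t$, while $e > 0$ excludes the origin. *)
pose x := (c + d) / 2; pose e := ((d - c) / 2) ^+ 2.
have e0 : 0 < e by rewrite exprn_gt0 //; lra.
suff : [set` s] `<=` translate counterexample_body (pt3 x (e - 2 * x ^+ 2) 12).
  move/ball_hull_sub_translate => /[apply].
  move/translateE; rewrite sub0r /counterexample_body /= !mxE /=.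
  by move=> [_ [_ _ + _]]; lra.
move=> p /= ps; apply/translateE; have := cds (- p 0 0) (map_f _ ps).
have [->|[t /= /andP[t1 t2] <-]] := sX _ ps;
    rewrite /counterexample_body /= !mxE /=.
  (* The point $(0, 1, 0)$ allows a rise of up to $1$ above $y = -2x^2$, and $e \le 1$ because
     $[c, d]$ lies in $[-1, 1]$. *)
  by move=> _; split; [|split]; rewrite /e /x; nra.
rewrite opprK => tcd.
have et : e <= (x - t) ^+ 2 by case: tcd; rewrite /e /x; nra.
by split; [|split]; rewrite /e /x; nra.
Qed.

Theorem theorem8 (R : realType) (k : nat) (hk : (0 < k)%N) :
  exists C X : set 'rV[R]_3,
    [/\ convex_body C, o_symmetric C, ball_hull C X 0 &
        forall (Y : set 'rV[R]_3) (n : nat),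
          Y `<=` X -> (Y #= `I_n)%card -> (n < k)%N -> ~ ball_hull C Y 0].
Proof.
exists counterexample_body, counterexample_points; split.
- split.
  + exact: counterexample_body_compact.
  + exact: counterexample_body_convex.
  + exact: counterexample_body_interior.
- exact: counterexample_body_sym.
- exact: ball_hull_counterexample_points.
- move=> Y n YX Yn _; apply: finite_counterexample_points YX.
  by apply/finite_setP; exists n.
Qed.
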